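(* Let $q$ be a power of an odd prime and let $a,b\in\mathbb{F}_q^{\times}$. Set $\lambda=a^2/b$ and assume that $\lambda\notin\{0,-1\}$. For $\mu\in\mathbb{F}_q\setminus\{0,-1\}$ let $a_q(\mu)$ be the trace of the Frobenius of the elliptic curve over $\mathbb{F}_q$ described by $y^2=(x-1)(x^2+\mu)$. Let $C$ be the hyperelliptic curve over $\mathbb{F}_q$ defined by the affine equation $y^2=(x^2+a)(x^4+b)$. Then $$|C(\mathbb{F}_q)|=2+q+\psi_{(2,4)}(a,b)=1+q-\phi(-b)\,a_q(\lambda)-\phi(-a)\,a_q(1/\lambda).$$ In particular, if $q\equiv 1\pmod 4$ and $\chi$ is a multiplicative character of order $4$ over $\mathbb{F}_q$, then $$|C(\mathbb{F}_q)|=1+q+q\,\phi(-b)\cdot{}_2F_1\left(\begin{matrix}\chi&\chi^3\\ {}&\epsilon\end{matrix}\Big|-\lambda\right)+q\,\phi(-a)\cdot{}_2F_1\left(\begin{matrix}\chi&\chi^3\\ {}&\epsilon\end{matrix}\Big|\frac{-1}{\lambda}\right),$$ and moreover $$\left|\phi(-b)\cdot{}_2F_1\left(\begin{matrix}\chi&\chi^3\\ {}&\epsilon\end{matrix}\Big|-\lambda\right)+\phi(-a)\cdot{}_2F_1\left(\begin{matrix}\chi&\chi^3\\ {}&\epsilon\end{matrix}\Big|\frac{-1}{\lambda}\right)\right|\le\frac{4}{\sqrt q}.$$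
   Context: The curve defined by an affine equation $y^2=f(x)$, with $f\in\mathbb{F}_q[x]$ monic, means the smooth projective model of that affine curve; when $\deg f$ is even it is obtained by adding two points at infinity, both rational over $\mathbb{F}_q$. For an elliptic curve $E$ over $\mathbb{F}_q$ the trace of the Frobenius is $1+q-|E(\mathbb{F}_q)|$. A multiplicative character $\chi$ on $\mathbb{F}_q$ is a homomorphism $\mathbb{F}_q^\times\to\mathbb{C}^\times$, extended by $\chi(0)=0$ (including for the trivial character $\epsilon$). $\phi$ is the quadratic character ($\phi(0)=0$). The character sum is $\psi_{(2,4)}(a,b)=\sum_{x\in\mathbb{F}_q}\phi(x^2+a)\phi(x^4+b)$. $\overline{B}=1/B$ denotes the inverse character. For characters $A,B$ put $J(A,B)=\sum_{x\in\mathbb{F}_q}A(x)B(1-x)$ and $\binom{A}{B}=\frac{B(-1)}{q}J(A,\overline{B})$. For characters $A_0,A_1,B_1$ and $x\in\mathbb{F}_q$, the Gaussian hypergeometric series is $${}_2F_1\left(\begin{matrix}A_0&A_1\\ {}&B_1\end{matrix}\Big|x\right)=\frac{q}{q-1}\sum_{\eta}\binom{A_0\eta}{\eta}\binom{A_1\eta}{B_1\eta}\eta(x),$$ the sum being over all multiplicative characters $\eta$ of $\mathbb{F}_q$. *)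

(* Defs.v *)
From HB Require Import structures.
From mathcomp Require Import all_boot all_order all_algebra all_fingroup all_field.
From mathcomp Require Import reals complex.

Set Implicit Arguments.
Unset Strict Implicit.
Unset Printing Implicit Defensive.

Import Order.TTheory GRing.Theory Num.Theory.
Local Open Scope ring_scope.

Section Curves.
Variable F : finFieldType.

(* With m = (size f)./2, i.e. deg f = 2m or 2m - 1, this is u^(2m) f(1/u). *)
Definition poly_at_inf (f : {poly F}) : {poly F} :=
  \poly_(i < ((size f)./2.*2).+1) f`_((size f)./2.*2 - i).

(* For f squarefree of degree at least 3, the smooth projective model of
   y^2 = f(x) is glued from the affine charts y^2 = f(x) and
   v^2 = u^(2m) f(1/u) along u = 1/x, v = y/x^m.  Its F-rational points are
   those of the first chart (inl) and those of the second chart lying over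
   u = 0 (inr v). *)
Definition model_points (f : {poly F}) : {set (F * F) + F} :=
  [set P | match P with
           | inl (x, y) => y ^+ 2 == f.[x]
           | inr v => v ^+ 2 == (poly_at_inf f).[0]
           end].

Definition frob_trace (f : {poly F}) : int :=
  1 + #|F|%:Z - #|model_points f|%:Z.

Definition ell_poly (mu : F) : {poly F} := ('X - 1) * ('X^2 + mu%:P).

Definition aq (mu : F) : int := frob_trace (ell_poly mu).

Definition hyp_poly (a b : F) : {poly F} := ('X^2 + a%:P) * ('X^4 + b%:P).

Lemma poly_at_inf0 (f : {poly F}) :
  (poly_at_inf f).[0] = f`_((size f)./2.*2).
Proof. by rewrite horner_coef0 coef_poly /= subn0. Qed.

Lemma card_model_points (f : {poly F}) :
  #|model_points f| = addn #|[set P : F * F | P.2 ^+ 2 == f.[P.1]]|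
                           #|[set v : F | v ^+ 2 == f`_((size f)./2.*2)]|.
Proof.
have -> : model_points f =
    (inl @: [set P : F * F | P.2 ^+ 2 == f.[P.1]]) :|:
    (inr @: [set v : F | v ^+ 2 == f`_((size f)./2.*2)]).
  apply/setP => -[[x y]|v]; rewrite !inE ?poly_at_inf0.
    apply/idP/orP => [h|[]/imsetP[z]]; first by left; apply: imset_f; rewrite inE.
      by rewrite inE => + [zE]; rewrite -zE.
    by [].
  apply/idP/orP => [h|[]/imsetP[z]]; first by right; apply: imset_f; rewrite inE.
    by [].
  by rewrite inE => h [->].
rewrite cardsU !card_imset; try by move=> ? ? [].
suff -> : forall (A : {set F * F}) (B : {set F}),
    [set (inl x : (F * F) + F) | x in A] :&: [set inr x | x in B] = set0.
  by rewrite cards0 subn0.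
move=> A B; apply/setP => z; rewrite !inE; apply/negP.
by case/andP => /imsetP[? _ ->] /imsetP[].
Qed.

Lemma card_model_points_even (f : {poly F}) : (2 : F) != 0 ->
  f \is monic -> odd (size f) ->
  #|model_points f| = #|[set P : F * F | P.2 ^+ 2 == f.[P.1]]|.+2.
Proof.
move=> ch2 /monicP fm odf; rewrite card_model_points.
have -> : f`_((size f)./2.*2) = 1.
  by rewrite -fm /lead_coef -[in RHS](odd_double_half (size f)) odf add1n.
suff -> : [set v : F | v ^+ 2 == 1] = [set 1; -1].
  rewrite cards2 -addr_eq0 -[1 + 1]/(2%:R) ch2.
  by rewrite addn2.
by apply/setP => v; rewrite !inE sqrf_eq1.
Qed.

Lemma card_model_points_odd (f : {poly F}) :
  ~~ odd (size f) ->
  #|model_points f| = #|[set P : F * F | P.2 ^+ 2 == f.[P.1]]|.+1.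
Proof.
move=> evf; rewrite card_model_points nth_default; last first.
  by rewrite -[leqLHS](odd_double_half (size f)) (negPf evf).
suff -> : [set v : F | v ^+ 2 == 0] = [set 0] by rewrite cards1 addn1.
by apply/setP => v; rewrite !inE sqrf_eq0.
Qed.

End Curves.

Section Characters.
Variables (F : finFieldType) (C : numClosedFieldType).

Definition is_mulchar (f : {ffun F -> C}) : bool :=
  [&& f 0 == 0,
      [forall x, (x != 0) ==> (f x != 0)]
    & [forall x, forall y,
        (x != 0) && (y != 0) ==> (f (x * y) == f x * f y)]].

Record mulchar := MulChar {
  mulchar_val :> {ffun F -> C};
  mulchar_valP : is_mulchar mulchar_val }.

HB.instance Definition _ := [isSub for mulchar_val].
HB.instance Definition _ := [Choice of mulchar by <:].

Lemma mulchar0 (A : mulchar) : A 0 = 0.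
Proof. by case/and3P: (mulchar_valP A) => /eqP. Qed.

Lemma mulchar_neq0 (A : mulchar) x : x != 0 -> A x != 0.
Proof. by case/and3P: (mulchar_valP A) => _ /forallP/(_ x)/implyP. Qed.

Lemma mulcharM (A : mulchar) x y : A (x * y) = A x * A y.
Proof.
have [->|x0] := eqVneq x 0; first by rewrite !(mul0r, mulchar0).
have [->|y0] := eqVneq y 0; first by rewrite !(mulr0, mulchar0).
case/and3P: (mulchar_valP A) => _ _ /forallP/(_ x)/forallP/(_ y).
by rewrite x0 y0 => /eqP.
Qed.

Lemma mulchar1 (A : mulchar) : A 1 = 1.
Proof.
apply: (mulfI (mulchar_neq0 A (oner_neq0 F))).
by rewrite -mulcharM !mulr1.
Qed.

Lemma mulcharX (A : mulchar) x n : A (x ^+ n) = A x ^+ n.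
Proof.
by elim: n => [|n IHn]; rewrite ?expr0 ?mulchar1 // !exprS mulcharM IHn.
Qed.

Lemma mulcharP (A B : mulchar) : A =1 B -> A = B.
Proof. by move=> AB; apply/val_inj/ffunP. Qed.

(* Values of characters satisfy z^q = z; this makes mulchar a finType. *)
Definition mulchar_vals : seq C :=
  projT1 (closed_field_poly_normal ('X^#|F| - 'X : {poly C})).

Lemma mem_mulchar_vals (A : mulchar) x : A x \in mulchar_vals.
Proof.
rewrite /mulchar_vals; case: closed_field_poly_normal => s /= Es.
have q_gt1 : (1 < #|F|)%N by exact: finNzRing_gt1.
have p_neq0 : 'X^#|F| - 'X != 0 :> {poly C}.
  apply/eqP => /(congr1 (fun p : {poly C} => p`_#|F|)).
  rewrite coefB coefXn eqxx coefX gtn_eqF // coef0 subr0.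
  by move/eqP; rewrite oner_eq0.
have: root ('X^#|F| - 'X) (A x).
  by rewrite rootE !hornerE -mulcharX expf_card subrr.
by rewrite Es rootZ ?lead_coef_eq0 // root_prod_XsubC.
Qed.

Definition mulchar_code (A : mulchar) : {ffun F -> 'I_(size mulchar_vals).+1} :=
  [ffun x => inord (index (A x) mulchar_vals)].

Definition mulchar_decode (g : {ffun F -> 'I_(size mulchar_vals).+1}) :
  option mulchar := insub [ffun x => nth 0 mulchar_vals (g x)].

Lemma mulchar_codeK : pcancel mulchar_code mulchar_decode.
Proof.
move=> A; rewrite /mulchar_decode.
have -> : [ffun x => nth 0 mulchar_vals (mulchar_code A x)] = val A.
  apply/ffunP => x; rewrite !ffunE inordK ?ltnS ?index_size //.
  by rewrite nth_index ?mem_mulchar_vals.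
exact: valK.
Qed.

HB.instance Definition _ : isCountable mulchar := PCanIsCountable mulchar_codeK.
HB.instance Definition _ : isFinite mulchar := PCanIsFinite mulchar_codeK.

(* The group of characters; its unit is the trivial character, with value 0
   at 0. *)
Lemma trivchar_subproof : is_mulchar [ffun x => (x != 0)%:R].
Proof.
apply/and3P; split.
- by rewrite ffunE eqxx.
- by apply/forallP => x; apply/implyP => x0; rewrite ffunE x0 oner_neq0.
- apply/forallP => x; apply/forallP => y; apply/implyP => /andP[x0 y0].
  by rewrite !ffunE mulf_neq0 // x0 y0 mulr1.
Qed.
Definition trivchar : mulchar := MulChar trivchar_subproof.

Lemma mulchar_mul_subproof (A B : mulchar) :
  is_mulchar [ffun x => A x * B x].
Proof.
apply/and3P; split.
- by rewrite ffunE !mulchar0 mulr0.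
- apply/forallP => x; apply/implyP => x0.
  by rewrite ffunE mulf_neq0 ?mulchar_neq0.
- apply/forallP => x; apply/forallP => y; apply/implyP => _.
  by rewrite !ffunE !mulcharM mulrACA.
Qed.
Definition mulchar_mul (A B : mulchar) : mulchar :=
  MulChar (mulchar_mul_subproof A B).

Lemma mulchar_inv_subproof (A : mulchar) : is_mulchar [ffun x => (A x)^-1].
Proof.
apply/and3P; split.
- by rewrite ffunE mulchar0 invr0.
- apply/forallP => x; apply/implyP => x0.
  by rewrite ffunE invr_neq0 ?mulchar_neq0.
- apply/forallP => x; apply/forallP => y; apply/implyP => _.
  by rewrite !ffunE mulcharM invfM.
Qed.
Definition mulchar_inv (A : mulchar) : mulchar :=
  MulChar (mulchar_inv_subproof A).

Lemma mulchar_mulA : associative mulchar_mul.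
Proof. by move=> A B D; apply: mulcharP => x; rewrite !ffunE mulrA. Qed.

Lemma mulchar_mul1 : left_id trivchar mulchar_mul.
Proof.
move=> A; apply: mulcharP => x; rewrite !ffunE.
by case: eqVneq => [->|]; rewrite ?mulchar0 ?mulr0 ?mul1r.
Qed.

Lemma mulchar_mulV : left_inverse trivchar mulchar_inv mulchar_mul.
Proof.
move=> A; apply: mulcharP => x; rewrite !ffunE.
have [->|x0] := eqVneq x 0; first by rewrite mulchar0 mulr0.
by rewrite mulVf ?mulchar_neq0.
Qed.

HB.instance Definition _ :=
  Finite_isGroup.Build mulchar mulchar_mulA mulchar_mul1 mulchar_mulV.

Definition quadchar (x : F) : C :=
  if x == 0 then 0 else if [exists y, x == y ^+ 2] then 1 else -1.

Definition psi24 (a b : F) : C :=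
  \sum_(x : F) quadchar (x ^+ 2 + a) * quadchar (x ^+ 4 + b).

Definition jacobi_sum (A B : mulchar) : C := \sum_(x : F) A x * B (1 - x).

Definition binom_char (A B : mulchar) : C :=
  B (-1) / #|F|%:R * jacobi_sum A (B^-1)%g.

Definition hyp2F1 (A0 A1 B1 : mulchar) (x : F) : C :=
  #|F|%:R / (#|F|%:R - 1) *
  \sum_(eta : mulchar)
    binom_char (A0 * eta)%g eta * binom_char (A1 * eta)%g (B1 * eta)%g * eta x.

End Characters.

Arguments quadchar {F} C x.
Arguments psi24 {F} C a b.

(* Main.v *)
Require Import Defs.
From mathcomp Require Import all_boot all_order all_algebra all_fingroup.
From mathcomp Require Import all_solvable all_field.
From mathcomp Require Import reals complex.
From mathcomp Require Import ring zify.

Set Implicit Arguments.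
Unset Strict Implicit.
Unset Printing Implicit Defensive.

Import Order.TTheory GRing.Theory Num.Theory.
Local Open Scope ring_scope.

(** Write phi for the quadratic character and S(mu) for the sum of
    phi((x - 1)(x^2 + mu)) over F, which is minus the trace a_q(mu).

    The sextic is a function of u = x^2, and u has 1 + phi(u) square roots, so
    psi_(2,4)(a, b) is the sum of phi over the cubic (u + a)(u^2 + b) plus the
    sum of phi over u(u + a)(u^2 + b).  The substitution u -> 1/u turns the
    quartic into a cubic at the price of the value 1 at the missing point, and
    scaling by a brings both cubics to the form (x - 1)(x^2 + mu)
    ([psi24_split]).

    For the hypergeometric values, summing over all characters eta leaves only
    the pairs (s, t) with -mu s t = (1 - s)(1 - t), weighted by chi(s / t)
    ([hyp2F1_point_sum]).  With s = r t this equation is quadratic in t, so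
    counting its roots gives the sum over r of chi(r) phi((1 - r)^2 - 4 r mu).
    Averaging r with 1/r replaces chi(r) by half the sum of phi(w) over the
    square roots w of r; after w -> i w with i^2 = -1 the summand depends on w
    only through phi(w) and z = w + 1/w, and phi(w) agrees with phi(z + 2) and
    with phi(z - 2) as soon as these are nonzero.  Summing over the fibres of
    w |-> z gives S(mu) ([sum_order4_ell], [hyp2F1_ell_sum]).

    The last inequality then amounts to |a_q(mu)| <= 2 sqrt(q), proved here
    along the lines of Manin's elementary argument.  Let f be a squarefree cubic
    x(x^2 + Ax + B).  On the curve f(t) y^2 = f(x) over F(t) there are the
    points T = (t, 1) and P = (t^q, f(t)^((q-1)/2)); let d(n) be the degree of
    the rational function x(P + nT).  The two numbers x(R + T) and x(R - T) are
    the roots of an explicit quadratic whose coefficients are forms in x(R)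
    without common factor, whence d(n+1) + d(n-1) = 2 d(n) + 2
    ([addition_forms_coprime], [hsize_addition_forms], [adjacent_succ]).  Only
    x-coordinates occur: the sequence is generated by the symmetric biquadratic
    relation between x(R) and x(R + T) ([adjacent]).  Hence, for n >= 0,
    d(n) = n^2 + (d(1) - q - 1) n + q, and similarly in the other direction with
    d(-1).  Counting the cancellations in x(P - T) and x(P + T) bounds d(-1) and
    d(1) by q + 1 + s and q + 1 - s, where s is the sum of phi(f(c)) over c in F
    ([hsize_shift_le]).  As d(n) >= 0, the quadratic
    n^2 - s n + q is nonnegative at all integers n, and taking n next to s/2
    gives s^2 <= 4 q ([hasse_cubic]). *)

(** * Polynomial preliminaries *)

Section Height.
Variable k : fieldType.
Implicit Types X Z U W V S : {poly k}.

(** The size, that is degree plus one, of the rational function X / Z when X and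
    Z are coprime. *)
Definition hsize X Z := maxn (size X) (size Z).

Lemma hsize_gt0 X Z : coprimep X Z -> (0 < hsize X Z)%N.
Proof.
rewrite /hsize leq_max !size_poly_gt0; have [->|//] := eqVneq X 0.
by rewrite coprime0p -size_poly_eq1 -size_poly_gt0 => /eqP ->.
Qed.

(** [size_mul] read in the ring structure of [k] as a field, so that the sizes below
    are all expressed in one structure. *)
Lemma size_polyM_field X Z : X != 0 -> Z != 0 -> size (X * Z) = (size X + size Z).-1.
Proof. exact: size_mul. Qed.

(** The entries on the left are the coefficients of (U T + W)(V T + S), so this is
    Gauss's lemma for the place at infinity: each factor has a coefficient of
    largest degree, and the product of the extreme ones cannot cancel. *)
Lemma hsize_product U W V S : (0 < hsize U W)%N -> (0 < hsize V S)%N ->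
  maxn (size (U * V)) (maxn (size (U * S + W * V)) (size (W * S)))
    = (hsize U W + hsize V S).-1.
Proof.
rewrite /hsize => UW VS; apply/eqP; rewrite eqn_leq; apply/andP; split.
  rewrite !geq_max (leq_trans (size_polyD _ _)) ?geq_max;
    by rewrite !(leq_trans (size_polyMleq _ _)) //; lia.
have le1 m n p r : (r <= m -> r <= maxn m (maxn n p))%N by lia.
have le2 m n p r : (r <= n -> r <= maxn m (maxn n p))%N by lia.
have le3 m n p r : (r <= p -> r <= maxn m (maxn n p))%N by lia.
have [leWU|ltUW] := leqP (size W) (size U); have [leSV|ltVS] := leqP (size S) (size V).
- have nU : U != 0 by rewrite -size_poly_gt0; lia.
  have nV : V != 0 by rewrite -size_poly_gt0; lia.
  by apply: le1; rewrite size_polyM_field //; lia.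
- have nS : S != 0 by rewrite -size_poly_gt0; lia.
  have nU : U != 0 by rewrite -size_poly_gt0; lia.
  move: leWU; rewrite leq_eqVlt => /orP[/eqP eWU|ltWU].
    have nW : W != 0 by rewrite -size_poly_gt0 eWU size_poly_gt0.
    by apply: le3; rewrite size_polyM_field //; lia.
  have lt : (size (W * V)%R < size (U * S)%R)%N.
    by rewrite (size_polyM_field nU nS); apply: leq_ltn_trans (size_polyMleq _ _) _; lia.
  by apply: le2; rewrite size_polyDl // size_polyM_field //; lia.
- have nV : V != 0 by rewrite -size_poly_gt0; lia.
  have nW : W != 0 by rewrite -size_poly_gt0; lia.
  have lt : (size (U * S)%R < size (W * V)%R)%N.
    by rewrite (size_polyM_field nW nV); apply: leq_ltn_trans (size_polyMleq _ _) _; lia.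
  by apply: le2; rewrite addrC size_polyDl // size_polyM_field //; lia.
- have nS : S != 0 by rewrite -size_poly_gt0; lia.
  have nW : W != 0 by rewrite -size_poly_gt0; lia.
  by apply: le3; rewrite size_polyM_field //; lia.
Qed.
End Height.

Section LinearFactors.
Variable k : fieldType.

(** Powers of distinct linear factors are pairwise coprime. *)
Lemma dvdp_prod_XsubC_exp (s : seq k) (e : k -> nat) (p : {poly k}) : uniq s ->
  (forall c, c \in s -> ('X - c%:P) ^+ e c %| p) ->
  \prod_(c <- s) ('X - c%:P) ^+ e c %| p.
Proof.
elim: s => [|c s IHs] /= => [_ _|/andP[cs us] h]; first by rewrite big_nil dvd1p.
rewrite big_cons Gauss_dvdp ?h ?mem_head //=; first by apply: IHs => // d ds;
  rewrite h // inE ds orbT.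
rewrite coprimep_expl // coprimep_sym coprimep_XsubC rootE horner_prod.
rewrite prodf_seq_neq0; apply/allP => d ds /=.
by rewrite horner_exp hornerXsubC expf_neq0 // subr_eq0; apply: contraNneq cs => ->.
Qed.

Lemma size_prod_XsubC_exp (s : seq k) (e : k -> nat) :
  size (\prod_(c <- s) ('X - c%:P) ^+ e c) = (\sum_(c <- s) e c).+1.
Proof.
elim: s => [|c s IHs]; first by rewrite !big_nil size_poly1.
rewrite !big_cons size_Mmonic ?size_exp_XsubC ?IHs //; first by rewrite addSn addnS.
  by rewrite expf_neq0 // polyXsubC_eq0.
by apply: monic_prod => d _; rewrite monic_exp ?monicXsubC.
Qed.
End LinearFactors.

(** * The x-coordinate recursion for repeated addition of a point *)

Section XOnly.
Variables (k : fieldType) (A B : k).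
Hypothesis two_neq0 : (2 : k) != 0.
Hypothesis B_neq0 : B != 0.
Hypothesis disc_neq0 : A ^+ 2 - 4 * B != 0.
Implicit Types X Z U W V S : {poly k}.

Notation t := ('X : {poly k}).

(** If x = X / Z is the abscissa of a point R on the curve
    f(t) y^2 = f(x), with f = x(x^2 + Ax + B), the addition formulas give
      x(R+T) x(R-T) = (t x - B)^2 / (x - t)^2,
      x(R+T) + x(R-T) = 2 ((t x + B)(x + t) + 2 A t x) / (x - t)^2
    for T = (t, 1).  The three forms below are the homogeneous denominator,
    numerator of the product, and numerator of the sum. *)
Definition xdiff X Z := (X - t * Z) ^+ 2.
Definition xprod X Z := (t * X - B%:P * Z) ^+ 2.
Definition xsum X Z :=
  2 * ((t * X + B%:P * Z) * (X + t * Z) + 2 * A%:P * t * X * Z).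

(** U / W is the abscissa of R + T or of R - T, for R of abscissa X / Z. *)
Definition adjacent U W X Z :=
  xdiff X Z * U ^+ 2 - xsum X Z * U * W + xprod X Z * W ^+ 2 = 0.

(** Written out, the relation is a biquadratic form symmetric in the two
    abscissas (R differs from R + T by T), which is what lets the sequence be
    continued. *)
Lemma adjacent_sym U W X Z : adjacent U W X Z -> adjacent X Z U W.
Proof. by rewrite /adjacent => <-; rewrite /xdiff /xprod /xsum; ring. Qed.

Lemma polyC_coprime (c : k) p : c != 0 -> coprimep p c%:P.
Proof.
move=> c0; rewrite coprimep_sym; apply/coprimepP => d dc _.
by rewrite -size_poly_eq1 -dvdp1; apply: dvdp_trans dc _;
  rewrite -polyC1 -[1](mulVf c0) polyCM dvdp_mull.
Qed.

(** A common prime factor of the first two forms divides X - tZ and tX - BZ, so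
    t^2 = B modulo that prime; the third form is then 4 f(t) Z^2, and f(t) = 0
    together with t^2 = B contradicts the squarefreeness of f. *)
Lemma addition_forms_coprime X Z d : coprimep X Z ->
  d %| xdiff X Z -> d %| xprod X Z -> d %| xsum X Z -> d %= 1.
Proof.
move=> cXZ dL dM dS.
have cZ : coprimep d Z.
  apply/coprimepP => e ed eZ.
  have eX : e %| X ^+ 2.
    have -> : X ^+ 2 = xdiff X Z + Z * (2 * t * X - t ^+ 2 * Z) by rewrite /xdiff; ring.
    exact: dvdp_add (dvdp_trans ed dL) (dvdp_mulr _ eZ).
  have : coprimep (X ^+ 2) Z by rewrite coprimep_expl.
  by move/coprimepP; apply.
have /Bezout_eq1_coprimepP [[u w] /= uw] := cXZ.
(* The two linear forms L = X - tZ and M = tX - BZ generate t^2 - B, so a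
   divisor of L^2 and M^2 divides its cube. *)
have dc : d %| (t ^+ 2 - B%:P) ^+ 3.
  pose L := X - t * Z; pose M := t * X - B%:P * Z.
  have -> : (t ^+ 2 - B%:P) ^+ 3 =
    ((u * t + w) * M - (u * B%:P + w * t) * L) ^+ 3.
    rewrite /L /M; congr (_ ^+ 3); rewrite -[LHS]mul1r -uw; ring.
  set p := u * t + w; set q := u * B%:P + w * t.
  have -> : (p * M - q * L) ^+ 3 =
    M ^+ 2 * (p ^+ 3 * M - 3 * p ^+ 2 * q * L) + L ^+ 2 * (3 * p * q ^+ 2 * M - q ^+ 3 * L).
    ring.
  exact: dvdp_add (dvdp_mulr _ dM) (dvdp_mulr _ dL).
(* Modulo L, the third form is 4 f(t) Z^2. *)
pose f := t * (t ^+ 2 + A%:P * t + B%:P).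
have df : d %| f ^+ 2.
  have : d %| (4%:P * f * Z ^+ 2) ^+ 2.
    pose L := X - t * Z.
    pose H := 2 * (t * L + 3 * t ^+ 2 * Z + B%:P * Z + 2 * A%:P * t * Z).
    have E : xsum X Z = 4%:P * f * Z ^+ 2 + L * H.
      by rewrite /xsum /f /H /L; ring.
    have -> : (4%:P * f * Z ^+ 2) ^+ 2 = xsum X Z * (xsum X Z - 2 * L * H) + L ^+ 2 * H ^+ 2.
      by rewrite E; ring.
    exact: dvdp_add (dvdp_mulr _ dS) (dvdp_mulr _ dL).
  have -> : (4%:P * f * Z ^+ 2) ^+ 2 = ((4 : k) ^+ 2)%:P * (Z ^+ 4 * f ^+ 2).
    by rewrite polyC_exp; ring.
  rewrite Gauss_dvdpr; last first.
    rewrite polyC_coprime // expf_neq0 //.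
    by rewrite (_ : 4 = 2 * 2 :> k) ?mulf_neq0 //; ring.
  by rewrite Gauss_dvdpr // coprimep_expr.
(* At a common root of t^2 - B and f, B != 0 excludes t = 0, so A t = -2B, and
   squaring gives A^2 = 4B. *)
have cop : coprimep (t ^+ 2 - B%:P) f.
  rewrite /f coprimepMr; apply/andP; split.
    have -> : t ^+ 2 - B%:P = t * t + - B%:P by ring.
    by rewrite coprimep_sym coprimep_addl_mul -polyCN polyC_coprime // oppr_eq0.
  have -> : t ^+ 2 + A%:P * t + B%:P = 1 * (t ^+ 2 - B%:P) + (A%:P * t + 2 * B%:P) by ring.
  rewrite coprimep_addl_mul; apply/Bezout_coprimepP.
  exists ((A ^+ 2)%:P, 2 * B%:P - A%:P * t) => /=.
  have -> : (A ^+ 2)%:P * (t ^+ 2 - B%:P)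
      + (2 * B%:P - A%:P * t) * (A%:P * t + 2 * B%:P) = (- B * (A ^+ 2 - 4 * B))%:P.
    by rewrite !(polyCM, polyCB, polyCN, polyC_exp) ; ring.
  by rewrite -size_poly_eq1 size_polyC mulf_neq0 // oppr_eq0.
have : coprimep ((t ^+ 2 - B%:P) ^+ 3) (f ^+ 2) by rewrite coprimep_expl ?coprimep_expr.
by move/coprimepP; apply.
Qed.

(** Multiplication by t prevents cancellation of leading terms: the degree of
    tX - BZ is one more than that of X when X dominates, and X - tZ plays the
    same part when Z does. *)
Lemma hsize_addition_forms X Z : (0 < hsize X Z)%N ->
  maxn (size (xprod X Z)) (maxn (size (xsum X Z)) (size (xdiff X Z)))
  = ((hsize X Z).*2.+1).
Proof.
move=> h0.
have sq (p : {poly k}) : p != 0 -> size (p ^+ 2) = (size p).*2.-1.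
  by move=> p0; rewrite expr2 size_polyM_field // addnn.
have szB (p : {poly k}) : size (B%:P * p) = size p by rewrite size_Cmul.
have szT (p : {poly k}) : (size (t * p)%R <= (size p).+1)%N.
  by rewrite (leq_trans (size_polyMleq _ _)) // size_polyX.
have szC (c : k) (p : {poly k}) : (size (c%:P * p)%R <= size p)%N.
  by rewrite mul_polyC size_scale_leq.
have szT1 (p : {poly k}) : p != 0 -> size (t * p) = (size p).+1.
  by move=> p0; rewrite mulrC size_mulX.
have szN (p q : {poly k}) : (size (p - q)%R <= maxn (size p) (size q))%N.
  by rewrite (leq_trans (size_polyD _ _)) // size_polyN.
have lL : (size (X - t * Z)%R <= (hsize X Z).+1)%N.
  by apply: leq_trans (szN _ _) _; have := szT Z; rewrite /hsize; lia.
have lM : (size (t * X - B%:P * Z)%R <= (hsize X Z).+1)%N.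
  by apply: leq_trans (szN _ _) _; have := szT X; have := szC B Z; rewrite /hsize; lia.
have sqle (p : {poly k}) m : (size p <= m.+1 -> size (p ^+ 2)%R <= m.*2.+1)%N.
  have [->|/sq ->] := eqVneq p 0; last by lia.
  by rewrite expr0n /= size_poly0.
apply/eqP; rewrite eqn_leq; apply/andP; split.
  rewrite !geq_max /xprod /xdiff !sqle //= andbT.
  have -> : xsum X Z = 2%:P * ((t * X + B%:P * Z) * (X + t * Z) + (2 * A)%:P * (t * (X * Z))).
    by rewrite /xsum polyCM; ring.
  apply: leq_trans (szC _ _) _.
  apply: leq_trans (size_polyD _ _) _; rewrite geq_max; apply/andP; split.
    apply: leq_trans (size_polyMleq _ _) _.
    have l1 : (size (t * X + B%:P * Z)%R <= (hsize X Z).+1)%N.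
      by apply: leq_trans (size_polyD _ _) _; have := szT X; have := szC B Z; rewrite /hsize; lia.
    have l2 : (size (X + t * Z)%R <= (hsize X Z).+1)%N.
      by apply: leq_trans (size_polyD _ _) _; have := szT Z; rewrite /hsize; lia.
    by lia.
  apply: leq_trans (szC _ _) _; apply: leq_trans (szT _) _.
  by have := size_polyMleq X Z; move: h0; rewrite /hsize; lia.
have [leZX|ltXZ] := leqP (size Z) (size X).
  have X0 : X != 0 by rewrite -size_poly_gt0; move: h0; rewrite /hsize; lia.
  have E : size (t * X - B%:P * Z) = (size X).+1.
    by rewrite size_polyDl szT1 // size_polyN szB.
  rewrite /xprod sq; last by rewrite -size_poly_gt0 E.
  by rewrite E /hsize; lia.
have Z0 : Z != 0 by rewrite -size_poly_gt0; lia.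
have E : size (X - t * Z) = (size Z).+1.
  by rewrite addrC size_polyDl size_polyN szT1 //; lia.
rewrite /xdiff (sq (X - t * Z)); last by rewrite -size_poly_gt0 E.
by rewrite E /hsize; lia.
Qed.

(** The second root V / S of the quadratic with root U / W.  Comparing the degrees
    of the coprime coefficients of the quadratic with those of the product of its
    two factors gives the second-order recursion for the degrees. *)
Lemma adjacent_succ U W X Z : coprimep U W -> coprimep X Z -> adjacent U W X Z ->
  exists V S, [/\ coprimep V S, adjacent X Z V S &
    (hsize V S + hsize U W = (hsize X Z).*2.+2)%N].
Proof.
move=> cUW cXZ adj.
have /Bezout_eq1_coprimepP [[u w] /= uw] := cUW.
pose a := xdiff X Z; pose b := xsum X Z; pose g := xprod X Z.
have E : a * U ^+ 2 = b * U * W - g * W ^+ 2.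
  by move: adj; rewrite /adjacent -/a -/b -/g => /eqP; rewrite -addrA addr_eq0 => /eqP ->; ring.
(* The quadratic a V^2 - b V S + g S^2 has the root U/W, hence a factor
   W V - U S over F(t).  Multiplying the unknown cofactor by the square of the
   Bezout relation u U + w W = 1 yields its coefficients without division. *)
pose S := u ^+ 2 * (b * U - W * g) + 2 * u * w * U * a + w ^+ 2 * W * a.
pose V := u ^+ 2 * U * g + 2 * u * w * W * g + w ^+ 2 * (b * W - U * a).
have WS : W * S = a.
  transitivity (u ^+ 2 * (b * U * W - g * W ^+ 2) + 2 * u * w * U * W * a + w ^+ 2 * W ^+ 2 * a).
    by rewrite /S; ring.
  rewrite -E; transitivity (a * (u * U + w * W) ^+ 2); first by ring.
  by rewrite uw expr1n mulr1.
have UV : U * V = g.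
  transitivity (u ^+ 2 * U ^+ 2 * g + 2 * u * w * U * W * g + w ^+ 2 * (b * U * W - a * U ^+ 2)).
    by rewrite /V; ring.
  rewrite E; transitivity (g * (u * U + w * W) ^+ 2); first by ring.
  by rewrite uw expr1n mulr1.
have USWV : U * S + W * V = b.
  transitivity (b * (u * U + w * W) ^+ 2
    + 2 * u * w * (a * U ^+ 2 - (b * U * W - g * W ^+ 2))).
    by rewrite /V /S; ring.
  by rewrite E uw; ring.
exists V, S.
have cVS : coprimep V S.
  apply/coprimepP => d dV dS; apply: (addition_forms_coprime cXZ).
  - by rewrite -/a -WS dvdp_mull.
  - by rewrite -/g -UV dvdp_mull.
  - by rewrite -/b -USWV dvdp_add // dvdp_mull.
split=> //.
  apply: adjacent_sym; rewrite /adjacent -/a -/b -/g -WS -UV -USWV; ring.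
have := hsize_addition_forms (hsize_gt0 cXZ); rewrite -/a -/b -/g -UV -USWV -WS.
rewrite hsize_product ?hsize_gt0 //.
by have := hsize_gt0 cUW; have := hsize_gt0 cVS; lia.
Qed.

(** The recursion of [adjacent_succ] makes the degree of the n-th term a monic
    quadratic polynomial in n, and degrees are nonnegative; the final - 1 converts
    a size into a degree. *)
Lemma hsize_quadratic_ge0 U W X Z : coprimep U W -> coprimep X Z -> adjacent U W X Z ->
  forall n : nat, 0 <= n%:Z ^+ 2 + ((hsize X Z)%:Z - (hsize U W)%:Z - 1) * n%:Z
    + (hsize U W)%:Z - 1.
Proof.
move=> cUW cXZ adj n.
pose h (n : nat) := n%:Z ^+ 2 + ((hsize X Z)%:Z - (hsize U W)%:Z - 1) * n%:Z + (hsize U W)%:Z.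
suff [X' [Z' [U' [W' [cUW' cXZ' _ hn _]]]]] : exists X' Z' U' W', [/\ coprimep U' W',
  coprimep X' Z', adjacent U' W' X' Z',
   (hsize U' W')%:Z = h n & (hsize X' Z')%:Z = h n.+1].
  by rewrite -/(h n) -hn; have := hsize_gt0 cUW'; lia.
elim: n => [|n [X' [Z' [U' [W' [cUW' cXZ' adj' hn hn1]]]]]].
  exists X, Z, U, W; split=> //; rewrite /h; lia.
have [V [S [cVS adjV hV]]] := adjacent_succ cUW' cXZ' adj'.
exists V, S, X', Z'; split=> //.
have -> : h n.+2 = 2 * h n.+1 + 2 - h n by rewrite /h; lia.
lia.
Qed.
End XOnly.

(** * Squares in a finite field *)

Section Euler.
Variable F : finFieldType.

Lemma finfield_prim_root : exists g : F, (#|F|.-1).-primitive_root g.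
Proof.
have n0 : (0 < #|F|.-1)%N by have := finNzRing_gt1 F; case: #|F| => [|[]].
pose s := enum [pred x : F | x != 0].
have [| | |g _ gP] := hasP (@cyclic.has_prim_root F #|F|.-1 s n0 _ _ _); last by exists g.
- apply/allP => x; rewrite mem_enum inE => x0; apply/unity_rootP.
  by apply: (mulfI x0); rewrite -exprS prednK ?expf_card ?mulr1 //; apply/card_gt0P; exists 0.
- exact: enum_uniq.
- by rewrite /s -cardE cardC1.
Qed.

Variable m : nat.
Hypothesis card_F : #|F| = m.*2.+1.

Lemma half_card_gt0 : (0 < m)%N.
Proof. by have := finNzRing_gt1 F; rewrite card_F; case: m. Qed.

Lemma expf_half2 (x : F) : x != 0 -> (x ^+ m) ^+ 2 = 1.
Proof.
move=> x0; apply: (mulfI x0).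
by rewrite -exprM muln2 -exprS -card_F expf_card mulr1.
Qed.

Lemma expf_half (x : F) : x != 0 -> (x ^+ m == 1) || (x ^+ m == -1).
Proof. by move=> /expf_half2/eqP; rewrite sqrf_eq1. Qed.

(** Write x as a power of a generator: the exponent is even exactly when x^m = 1. *)
Lemma euler_criterion (x : F) : x != 0 -> [exists y, x == y ^+ 2] = (x ^+ m == 1).
Proof.
move=> x0; apply/existsP/eqP => [[y /eqP xy]|xm].
  have y0 : y != 0 by apply: contraNneq x0 => y0; rewrite xy y0 expr0n.
  by rewrite xy -exprM mulnC exprM expf_half2.
have [g gP] := finfield_prim_root.
have x1 : x ^+ #|F|.-1 = 1 by rewrite card_F /= -muln2 exprM xm expr1n.
have [[i /= _] xi] := prim_rootP gP x1.
move: xm; rewrite xi -exprM => /eqP; rewrite -(prim_order_dvd gP) card_F /= -muln2 mulnC.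
rewrite dvdn_pmul2r ?half_card_gt0 // => /dvdnP[j ->].
by exists (g ^+ j); rewrite exprM.
Qed.

(** The additive group of F has odd order, so 2 acts injectively on it. *)
Lemma two_neq0_odd : (2 : F) != 0.
Proof.
apply/eqP => h2.
have : (#|F|%:R : F) = 0.
  by have := expg_cardG (in_setT (1 : F)); rewrite cardsT FinRing.zmodXgE.
by rewrite card_F -addn1 natrD -muln2 natrM h2 mulr0 add0r => /eqP; rewrite oner_eq0.
Qed.

End Euler.

(** * The Hasse bound for y^2 = x(x^2 + Ax + B) *)

Section Start.
Variables (F : finFieldType) (p n m : nat) (A B : F).
Hypothesis p_prime : prime p.
Hypothesis card_F : #|F| = (p ^ n)%N.
Hypothesis odd_F : #|F| = m.*2.+1.
Hypothesis B_neq0 : B != 0.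
Hypothesis disc_neq0 : A ^+ 2 - 4 * B != 0.
Notation t := ('X : {poly F}).
Notation Q := ('X^#|F| : {poly F}).

Definition cubic : {poly F} := t * (t ^+ 2 + A%:P * t + B%:P).

(** For e = 1, -1, the numerator over (t^q - t)^2 of the abscissa of the difference
    and of the sum of the points (t^q, f(t)^((q-1)/2)) and (t, 1). *)
Definition shift_num (e : F) : {poly F} :=
  (t * Q + B%:P) * (Q + t) + (2 * A)%:P * (t * Q) + (2 * e)%:P * cubic ^+ m.+1.
Definition shift_den : {poly F} := (Q - t) ^+ 2.

(** By Euler's criterion this is, for e = 1, -1, the number of c with
    phi(f(c)) = e. *)
Definition value_count (e : F) : nat := \sum_(c : F) (cubic.[c] ^+ m == e).

Definition zero_count : nat := \sum_(c : F) (cubic.[c] == 0%R).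

(** The coefficients of f lie in F, so f(t)^q = f(t^q). *)
Lemma frob_cubic : cubic ^+ #|F| = Q * (Q ^+ 2 + A%:P * Q + B%:P).
Proof.
have qpoly : [pchar {poly F}].-nat #|F|.
  have pF := card_finPcharP card_F p_prime.
  rewrite card_F; rewrite pnatX; apply/orP; left.
  by rewrite pnatE ?pchar_poly.
rewrite exprMn !exprDn_pchar // [(A%:P * _) ^+ _]exprMn -!polyC_exp !expf_card.
by rewrite -!exprM [(2 * _)%N]mulnC.
Qed.

(** The numerators for e and -e are conjugate: their product is governed by
    x(P+T) x(P-T). *)
Lemma shift_num_prod e : e ^+ 2 = 1 ->
  shift_num e * shift_num (- e) = xprod B Q 1 * shift_den.
Proof.
move=> e2.
have E : cubic ^+ m.+1 * cubic ^+ m.+1 = cubic * (Q * (Q ^+ 2 + A%:P * Q + B%:P)).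
  by rewrite -frob_cubic odd_F -exprD -exprS; congr (_ ^+ _); lia.
transitivity (((t * Q + B%:P) * (Q + t) + (2 * A)%:P * (t * Q)) ^+ 2
    - (4 * e ^+ 2)%:P * (cubic ^+ m.+1 * cubic ^+ m.+1)).
  by rewrite /shift_num !(mulrN, polyCN, polyCM, polyC_exp); ring.
by rewrite E e2 /xprod /shift_den /cubic !polyCM; ring.
Qed.

Lemma shift_adjacent e : e ^+ 2 = 1 ->
  shift_num e ^+ 2 - xsum A B Q 1 * shift_num e + xprod B Q 1 * shift_den = 0.
Proof.
move=> e2; rewrite -(shift_num_prod e2).
rewrite /xsum /shift_num !mulrN !polyCN !polyCM; ring.
Qed.

(** At a point c of F, t^q takes the value c, so the numerator vanishes when
    f(c) = 0 or when f(c)^m = - e; these are the points where it can cancel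
    against (t^q - t)^2. *)
Lemma horner_shift_num e c : (shift_num e).[c] = 2 * cubic.[c] * (1 + e * cubic.[c] ^+ m).
Proof.
rewrite /shift_num /cubic !(hornerE, horner_exp, hornerXn) /= expf_card exprS; ring.
Qed.

Lemma size_shift_num e : (size (shift_num e) <= #|F|.*2.+2)%N.
Proof.
have szD (p1 q1 : {poly F}) l : (size p1 <= l -> size q1 <= l -> size (p1 + q1)%R <= l)%N.
  by move=> h1 h2; apply: leq_trans (size_polyD _ _) _; rewrite geq_max h1.
have szM (p1 q1 : {poly F}) l1 l2 l : (size p1 <= l1 -> size q1 <= l2 -> l1 + l2 <= l.+1
  -> size (p1 * q1)%R <= l)%N.
  by move=> h1 h2 h3; apply: leq_trans (size_polyMleq _ _) _; lia.
have szC (c : F) : (size c%:P <= 1)%N by rewrite size_polyC leq_b1.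
have szQ : (size Q <= #|F|.+1)%N by rewrite size_polyXn.
have szt : (size t <= 2)%N by rewrite size_polyX.
have szc : (size cubic <= 4)%N.
  apply: (szM _ _ 2 3)%N => //; apply: (szD _ _ _); first apply: (szD _ _ _);
    rewrite ?size_polyXn //.
    by apply: (szM _ _ 1 2)%N.
  exact: leq_trans (szC _) _.
have szX l : (size (cubic ^+ l)%R <= (l * 3).+1)%N.
  elim: l => [|l IHl]; first by rewrite expr0 size_poly1.
  by rewrite exprS; apply: (szM _ _ 4 (l * 3).+1)%N => //; lia.
have := half_card_gt0 odd_F => m0.
have sztQ : (size (t * Q)%R <= #|F|.+2)%N by apply: (szM _ _ 2 #|F|.+1)%N => //; lia.
apply: (szD _ _ _); first apply: (szD _ _ _).
- apply: (szM _ _ #|F|.+2 #|F|.+1)%N => //; last by lia.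
    by apply: (szD _ _ _) => //; apply: leq_trans (szC _) _.
  by apply: (szD _ _ _) => //; apply: leq_trans szt _; lia.
- by apply: (szM _ _ 1 #|F|.+2)%N => //; lia.
- by apply: (szM _ _ 1 (m.+1 * 3).+1)%N => //; lia.
Qed.

(** A multiplicity with which t - c divides both [shift_num e] and [shift_den]. *)
Definition cancel_mult (e c : F) : nat :=
  ((cubic.[c] == 0%R) + 2 * (cubic.[c] ^+ m == - e)%R)%N.

Lemma cubic_half0 c e : e ^+ 2 = 1 -> cubic.[c] = 0 -> (cubic.[c] ^+ m == e) = false.
Proof.
move=> e2 ->; rewrite expr0n eqn0Ngt (half_card_gt0 odd_F) /=; apply/eqP => e0.
by move: e2; rewrite -e0 expr0n => /eqP; rewrite eq_sym oner_eq0.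
Qed.

Lemma XsubC_dvd_frob (c : F) : 'X - c%:P %| Q - t.
Proof. by rewrite dvdp_XsubCl rootE !hornerE expf_card subrr. Qed.

Lemma cancel_dvd_num e c : e ^+ 2 = 1 -> ('X - c%:P) ^+ cancel_mult e c %| shift_num e.
Proof.
move=> e2; have e2N : (- e) ^+ 2 = 1 by rewrite sqrrN.
rewrite /cancel_mult; have [c0|c0] := eqVneq cubic.[c] 0.
  by rewrite cubic_half0 //= muln0 addn0 expr1 dvdp_XsubCl rootE horner_shift_num c0 mulr0 mul0r.
have [ce|//] := eqVneq (cubic.[c] ^+ m) (- e); last by rewrite muln0 expr0 dvd1p.
rewrite /= muln1 add0n.
(* (X - c)^2 divides the product with the conjugate numerator, which does not
   vanish at c. *)
rewrite -(@Gauss_dvdpl _ _ (shift_num (- e))).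
  by rewrite shift_num_prod // dvdp_mull // dvdp_exp2r // XsubC_dvd_frob.
rewrite coprimep_expl // coprimep_sym coprimep_XsubC rootE horner_shift_num ce.
by rewrite mulrNN -expr2 e2 -[1 + 1]/(2%:R) !mulf_neq0 // (two_neq0_odd odd_F).
Qed.

Lemma cancel_dvd_den e c : e ^+ 2 = 1 -> ('X - c%:P) ^+ cancel_mult e c %| shift_den.
Proof.
move=> e2; have e2N : (- e) ^+ 2 = 1 by rewrite sqrrN.
apply: (@dvdp_trans _ (('X - c%:P) ^+ 2)); last by rewrite dvdp_exp2r // XsubC_dvd_frob.
rewrite dvdp_exp2l // /cancel_mult; have [c0|c0] := eqVneq cubic.[c] 0; last by case: (_ == _).
by rewrite cubic_half0.
Qed.

Lemma value_count_total : (value_count 1%R + value_count (-1)%R + zero_count = #|F|)%N.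
Proof.
rewrite /value_count /zero_count -!big_split -sum1_card /=; apply: eq_bigr => c _.
have N1 : (-1) ^+ 2 = 1 :> F by rewrite sqrrN expr1n.
have [c0|c0] := eqVneq cubic.[c] 0; first by rewrite !cubic_half0 // expr1n.
have n1 : (1 : F) == -1 = false.
  by apply/negbTE; rewrite -addr_eq0 -[1 + 1]/(2%:R) (two_neq0_odd odd_F).
by case/orP: (expf_half odd_F c0) => /eqP ->; rewrite ?eqxx ?n1 // eq_sym n1.
Qed.

(** The numerator has degree at most 2q + 1, and the cancellations remove twice
    the number of c with f(c)^m = - e and once the number of zeros of f. *)
Lemma hsize_shift_le e : (e == 1) || (e == -1) -> exists X Z : {poly F},
  [/\ coprimep X Z, adjacent A B Q 1 X Z &
   (hsize X Z + value_count (- e)%R <= #|F| + value_count e + 2)%N].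
Proof.
move=> e1; have e2 : e ^+ 2 = 1 by case/orP: e1 => /eqP ->; rewrite ?sqrrN expr1n.
pose N := shift_num e; pose D := shift_den; pose G : {poly F} := gcdp N D.
have D0 : D != 0.
  rewrite expf_neq0 // -size_poly_eq0 size_polyDl ?size_polyXn // size_polyN size_polyX.
  by rewrite odd_F; have := half_card_gt0 odd_F; lia.
have G0 : G != 0 by rewrite gcdp_eq0 negb_and D0 orbT.
pose X : {poly F} := N %/ G; pose Z : {poly F} := D %/ G.
have NX : N = X * G by rewrite /X divpK // dvdp_gcdl.
have DZ : D = Z * G by rewrite /Z divpK // dvdp_gcdr.
exists X, Z; split; first by rewrite coprimep_div_gcd // D0 orbT.
  apply: adjacent_sym; rewrite /adjacent; apply: (mulIf (expf_neq0 2 G0)); rewrite mul0r.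
  transitivity (xdiff Q 1 * N ^+ 2 - xsum A B Q 1 * N * D + xprod B Q 1 * D ^+ 2).
    by rewrite NX DZ; ring.
  have -> : xdiff Q 1 = D by rewrite /xdiff /D /shift_den mulr1.
  transitivity (D * (N ^+ 2 - xsum A B Q 1 * N + xprod B Q 1 * D)); first by ring.
  by rewrite shift_adjacent // mulr0.
have sG : (\sum_(c : F) cancel_mult e c < size G)%N.
  rewrite -size_prod_XsubC_exp; apply: dvdp_leq => //.
  by rewrite dvdp_gcd !dvdp_prod_XsubC_exp ?index_enum_uniq // => c _;
    rewrite ?cancel_dvd_num ?cancel_dvd_den.
have sE : (\sum_(c : F) cancel_mult e c = zero_count + 2 * value_count (- e)%R)%N.
  by rewrite big_split /= -big_distrr.
have vt : (value_count e + value_count (- e)%R + zero_count = #|F|)%N.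
  by case/orP: e1 => /eqP ->; rewrite ?opprK; [|rewrite [X in (X + _)%N]addnC];
    apply: value_count_total.
have sN : (size N <= #|F|.*2.+2)%N by apply: size_shift_num.
have sD : (size D <= #|F|.*2.+2)%N.
  have sQ : size (Q - t) = #|F|.+1.
    by rewrite size_polyDl ?size_polyXn // size_polyN size_polyX odd_F;
      have := half_card_gt0 odd_F; lia.
  by rewrite /D /shift_den expr2 (leq_trans (size_polyMleq _ _)) // sQ; lia.
have szM (P R : {poly F}) : P != 0 -> R != 0 -> size (P * R) = (size P + size R).-1.
  exact: size_mul.
have szX : (size X + size G <= #|F|.*2.+3)%N.
  have [X0|X0] := eqVneq X 0; last by move: sN; rewrite NX szM // => h; lia.
  have sGD : (size G <= size D)%N by apply: dvdp_leq D0 (dvdp_gcdr N D).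
  by rewrite X0 size_poly0; lia.
have szZ : (size Z + size G <= #|F|.*2.+3)%N.
  have Z0 : Z != 0 by apply: contraNneq D0 => Z0; rewrite DZ Z0 mul0r.
  by move: sD; rewrite DZ szM //; lia.
have -> : hsize X Z = maxn (size X) (size Z) by [].
lia.
Qed.

(** With s the difference of the two counts, the quadratic n^2 + s n + q is
    nonnegative at every integer n; positive and negative n come from the two
    starting pairs e = 1 and e = -1. *)
Lemma hasse_cubic :
  ((value_count 1)%:Z - (value_count (-1))%:Z) ^+ 2 <= 4 * #|F|%:Z.
Proof.
pose s : int := (value_count 1)%:Z - (value_count (-1))%:Z.
have cQ : coprimep Q 1 by rewrite coprimep1.
have hQ : hsize Q 1 = #|F|.+1.
  by rewrite /hsize size_polyXn size_poly1; apply/maxn_idPl.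
have quad (e : F) : (e == 1) || (e == -1) -> forall j : nat,
    0 <= j%:Z ^+ 2 + ((value_count e)%:Z - (value_count (- e)%R)%:Z) * j%:Z + #|F|%:Z.
  move=> e1 j; have [X [Z [cXZ adj hXZ]]] := hsize_shift_le e1.
  have := hsize_quadratic_ge0 (two_neq0_odd odd_F) B_neq0 disc_neq0 cQ cXZ adj j; rewrite hQ.
  move/le_trans; apply; move: hXZ; set vN := value_count (- e); set vP := value_count e => hXZ.
  have : ((hsize X Z)%:Z - #|F|.+1%:Z - 1) * j%:Z <= (vP%:Z - vN%:Z) * j%:Z.
    by apply: ler_wpM2r; lia.
  lia.
have q1 j : 0 <= j%:Z ^+ 2 + s * j%:Z + #|F|%:Z by have := quad 1 _ j; rewrite eqxx => /(_ isT).
have q2 j : 0 <= j%:Z ^+ 2 - s * j%:Z + #|F|%:Z.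
  have := quad (-1) _ j; rewrite eqxx orbT opprK => /(_ isT).
  by congr (0 <= _); rewrite /s; ring.
rewrite -/s; move: q1 q2; rewrite odd_F => q1 q2.
(* The point j nearest to half of l = |s|.  For odd l the estimate falls short
   by one, which is recovered because h(h+1) is even and q is odd. *)
have key (l : nat) : 0 <= (l./2)%:Z ^+ 2 - l%:Z * (l./2)%:Z + (m.*2.+1)%:Z
  -> l%:Z ^+ 2 <= 4 * (m.*2.+1)%:Z.
  have := odd_double_half l; set h := l./2.
  have hh : (h * h.+1 = (h * h.+1)./2.*2)%N.
    by rewrite -[LHS]odd_double_half oddM oddS andbN.
  move: ((h * h.+1)./2) hh => w hh; case: (odd l) => /= <-; nia.
have [s0|s0] := leP 0 s.
  have -> : s = (`|s|%N)%:Z by lia.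
  by apply: key; have := q2 (`|s|%N./2); lia.
have -> : s ^+ 2 = (`|s|%N)%:Z ^+ 2 by lia.
by apply: key; have := q1 (`|s|%N./2); lia.
Qed.
End Start.

(** * The quadratic character and point counts *)

Section QuadChar.
Variables (F : finFieldType) (C : numClosedFieldType) (m : nat).
Hypothesis odd_F : #|F| = m.*2.+1.
Notation phi := (@quadchar F C).
Let two_neq0 : (2 : F) != 0 := two_neq0_odd odd_F.

Lemma quadchar0 : phi 0 = 0.
Proof. by rewrite /quadchar eqxx. Qed.

Lemma quadcharE x : x != 0 -> phi x = if x ^+ m == 1 then 1 else -1.
Proof. by move=> x0; rewrite /quadchar (negbTE x0) (euler_criterion odd_F). Qed.

Lemma one_eqN1 : (1 == -1 :> F) = false.
Proof. by apply/negbTE; rewrite -addr_eq0 -[1 + 1]/(2%:R). Qed.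

Lemma quadcharM x y : phi (x * y) = phi x * phi y.
Proof.
have [->|x0] := eqVneq x 0; first by rewrite mul0r quadchar0 mul0r.
have [->|y0] := eqVneq y 0; first by rewrite mulr0 quadchar0 mulr0.
rewrite !quadcharE ?mulf_neq0 // exprMn.
by case/orP: (expf_half odd_F x0) => /eqP ->; case/orP: (expf_half odd_F y0) => /eqP ->;
  rewrite ?(mulr1, mul1r, mulrNN, eqxx) // ?[-1 == 1]eq_sym one_eqN1 ?(mulr1, mul1r, mulrNN).
Qed.

Lemma quadchar_sqr x : x != 0 -> phi (x ^+ 2) = 1.
Proof.
move=> x0; rewrite /quadchar expf_eq0 (negbTE x0).
by have -> : [exists y, x ^+ 2 == y ^+ 2] by apply/existsP; exists x.
Qed.

Lemma quadchar1 : phi 1 = 1.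
Proof. by rewrite -(expr1n F 2) quadchar_sqr ?oner_neq0. Qed.

Lemma quadchar_unit x : x != 0 -> phi x * phi x = 1.
Proof. by move=> x0; rewrite -quadcharM -expr2 quadchar_sqr. Qed.

Lemma quadchar_norm x : `|phi x| <= 1.
Proof.
by rewrite /quadchar; case: ifP => _; [rewrite normr0 ler01|case: ifP => _;
  rewrite ?normrN normr1].
Qed.

Lemma sum_sqrt c : \sum_(y : F) (y ^+ 2 == c)%:R = 1 + phi c.
Proof.
rewrite /quadchar; have [->|c0] := eqVneq c 0.
  rewrite (bigD1 0) //= expr0n eqxx big1 ?addr0 // => y y0.
  by rewrite expf_eq0 (negbTE y0).
case: existsP => [[y /eqP cy]|no].
  have y0 : y != 0 by apply: contraNneq c0 => y0; rewrite cy y0 expr0n.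
  rewrite (bigD1 y) //= cy eqxx (bigD1 (- y)) /=; last first.
    by rewrite eq_sym -addr_eq0 -mulr2n -mulr_natl mulf_neq0.
  rewrite sqrrN eqxx big1 ?addr0 // => z /andP[zy zNy].
  by rewrite eqf_sqr (negbTE zy) (negbTE zNy).
rewrite big1 ?subrr // => y _.
by case: eqP => // h; case: no; exists y; rewrite h.
Qed.

Lemma sum_fun_sqr (g : F -> C) : \sum_x g (x ^+ 2) = \sum_u g u * (1 + phi u).
Proof.
under [RHS]eq_bigr => u _ do rewrite -sum_sqrt mulr_sumr.
rewrite exchange_big /=; apply: eq_bigr => x _.
rewrite (bigD1 (x ^+ 2)) //= eqxx mulr1 big1 ?addr0 // => u.
by rewrite eq_sym => /negbTE ->; rewrite mulr0.
Qed.

(** Completing the square reduces to [sum_sqrt]. *)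
Lemma sum_quadratic_roots a b c : a != 0 ->
  \sum_(x : F) (a * x ^+ 2 + b * x + c == 0)%:R = 1 + phi (b ^+ 2 - 4 * a * c).
Proof.
move=> a0; rewrite -sum_sqrt.
have n2a : 2 * a != 0 by rewrite mulf_neq0.
have inj : injective (fun x => 2 * a * x + b) by move=> x y /addIr /(mulfI n2a).
rewrite [RHS](reindex_inj inj) /=; apply: eq_bigr => x _; congr (_ %:R); congr (nat_of_bool _).
rewrite -[RHS]subr_eq0.
have -> : (2 * a * x + b) ^+ 2 - (b ^+ 2 - 4 * a * c)
  = 2 * 2 * a * (a * x ^+ 2 + b * x + c) by ring.
by rewrite mulf_eq0 -mulrA mulf_eq0 (negbTE two_neq0) (negbTE n2a).
Qed.

Lemma card_affine (f : {poly F}) :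
  (#|[set P : F * F | P.2 ^+ 2 == f.[P.1]]|%:R : C) = #|F|%:R + \sum_x phi f.[x].
Proof.
transitivity (\sum_(x : F) \sum_(y : F) (y ^+ 2 == f.[x])%:R : C).
  rewrite pair_bigA -sum1_card natr_sum big_mkcond /=; apply: eq_bigr => -[x y] _.
  by rewrite inE /=; case: (_ == _).
by under eq_bigr => x _ do rewrite sum_sqrt; rewrite big_split /= sumr_const.
Qed.

Lemma hyp_poly_monic (a b : F) : hyp_poly a b \is monic.
Proof.
by rewrite /hyp_poly monicMl monicE lead_coefDl ?lead_coefXn ?size_polyXn // size_polyC;
  case: eqP.
Qed.

Lemma size_hyp_poly (a b : F) : size (hyp_poly a b) = 7%N.
Proof.
rewrite /hyp_poly size_mul ?size_XnaddC // -size_poly_eq0 size_XnaddC //.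
Qed.

Lemma card_hyp_points (a b : F) :
  #|model_points (hyp_poly a b)|%:R = 2 + #|F|%:R + psi24 C a b.
Proof.
rewrite card_model_points_even ?hyp_poly_monic ?size_hyp_poly // -addn2 natrD card_affine.
rewrite addrC addrA /psi24; congr (_ + _); apply: eq_bigr => x _.
by rewrite -quadcharM /hyp_poly !hornerE.
Qed.

Definition ell_sum (mu : F) : C := \sum_(x : F) phi ((x - 1) * (x ^+ 2 + mu)).

Lemma size_ell_poly (mu : F) : size (ell_poly mu) = 4%N.
Proof.
by rewrite /ell_poly -polyC1 size_mul ?size_XnaddC ?size_XsubC ?polyXsubC_eq0
  // -size_poly_eq0 size_XnaddC.
Qed.

Lemma aq_ell_sum (mu : F) : (aq mu)%:~R = - ell_sum mu.
Proof.
rewrite /aq /frob_trace card_model_points_odd ?size_ell_poly //.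
rewrite -addn1 PoszD !(rmorphD, rmorphN) /= -!pmulrn card_affine.
rewrite /ell_sum; under [in RHS]eq_bigr => x _.
  rewrite (_ : (x - 1) * _ = (ell_poly mu).[x]); last by rewrite /ell_poly !hornerE.
  over.
ring.
Qed.

(** Pass to u = x^2, invert u in the summand containing phi(u), and rescale by
    - a or - 1/a.  The leading 1 is the value of the inverted summand at 0. *)
Lemma psi24_split (a b : F) : a != 0 -> b != 0 ->
  1 + psi24 C a b = phi (- b) * ell_sum (a ^+ 2 / b) + phi (- a) * ell_sum (1 / (a ^+ 2 / b)).
Proof.
move=> a0 b0; rewrite addrC.
have -> : psi24 C a b = \sum_u phi ((u + a) * (u ^+ 2 + b)) * (1 + phi u).
  rewrite -(sum_fun_sqr (fun u => phi ((u + a) * (u ^+ 2 + b)))).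
  by apply: eq_bigr => x _; rewrite -quadcharM -exprM.
under eq_bigr => u _ do rewrite mulrDr mulr1 -quadcharM.
rewrite big_split /= -addrA addrC [_ + 1]addrC; congr (_ + _); last first.
  rewrite /ell_sum mulr_sumr (reindex_inj (mulfI (_ : - a != 0))) ?oppr_eq0 //=.
  apply: eq_bigr => v _; rewrite -quadcharM -[LHS]mulr1 -(@quadchar_sqr a^-1) ?invr_neq0
    // -quadcharM.
  by congr phi; field; rewrite a0 b0.
rewrite (bigD1 0) //= mulr0 quadchar0 add0r.
have -> : \sum_(u | u != 0) phi ((u + a) * (u ^+ 2 + b) * u)
        = \sum_(u | u != 0) phi ((1 + a * u) * (1 + b * u ^+ 2)).
  rewrite (reindex_inj invr_inj) /=; apply: eq_big => u; first by rewrite invr_eq0.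
  rewrite invr_eq0 => u0; rewrite -[LHS]mulr1 -(@quadchar_sqr (u ^+ 2)) ?expf_neq0 // -quadcharM.
  by congr phi; field.
have -> : 1 + \sum_(u | u != 0) phi ((1 + a * u) * (1 + b * u ^+ 2))
        = \sum_u phi ((1 + a * u) * (1 + b * u ^+ 2)).
  by rewrite [RHS](bigD1 0) //= mulr0 expr0n mulr0 !addr0 mulr1 quadchar1.
rewrite /ell_sum mulr_sumr (reindex_inj (mulfI (_ : - a^-1 != 0))) ?oppr_eq0 ?invr_eq0 //=.
apply: eq_bigr => v _; rewrite -quadcharM -[RHS]mulr1 -(@quadchar_sqr a^-1) ?invr_neq0
  // -quadcharM.
by congr phi; field; rewrite a0 b0.
Qed.

(** The shift x -> x + 1 turns (x - 1)(x^2 + mu) into the cubic with A = 2 and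
    B = 1 + mu, of discriminant A^2 - 4B = - 4 mu. *)
Lemma ell_sum_cubic (mu : F) :
  ell_sum mu = (value_count m 2 (1 + mu) 1)%:R - (value_count m 2 (1 + mu) (-1))%:R.
Proof.
rewrite /ell_sum (reindex_inj (addrI 1)) /= /value_count !natr_sum -sumrB.
apply: eq_bigr => c _.
rewrite (_ : _ * _ = (cubic 2 (1 + mu)).[c]); last by rewrite /cubic !hornerE /=; ring.
have [->|c0] := eqVneq (cubic 2 (1 + mu)).[c] 0.
  rewrite quadchar0 expr0n eqn0Ngt (half_card_gt0 odd_F) /= ![0 == _]eq_sym oner_eq0 oppr_eq0
    oner_eq0 subrr //.
rewrite quadcharE //; case/orP: (expf_half odd_F c0) => /eqP ->.
  by rewrite eqxx one_eqN1 subr0.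
by rewrite eqxx eq_sym one_eqN1 sub0r.
Qed.

Lemma hasse_aq p n (mu : F) : prime p -> #|F| = (p ^ n)%N -> mu != 0 -> mu != -1 ->
  (aq mu) ^+ 2 <= 4 * #|F|%:Z.
Proof.
move=> p_prime card_F mu0 mu1.
have -> : (aq mu) ^+ 2 = ((value_count m 2 (1 + mu) 1)%:Z - (value_count m 2 (1
  + mu) (-1))%:Z) ^+ 2.
  apply/eqP; rewrite -(eqr_int C) !rmorphXn /= aq_ell_sum ell_sum_cubic rmorphB /= -!pmulrn sqrrN.
  exact/eqP.
apply: (hasse_cubic p_prime card_F odd_F).
  by rewrite addrC addr_eq0.
have -> : 2 ^+ 2 - 4 * (1 + mu) = - (2 * 2 * mu) :> F by ring.
by rewrite oppr_eq0 !mulf_neq0.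
Qed.
End QuadChar.

(** * Orthogonality of multiplicative characters *)

Section Orthogonality.
Variables (F : finFieldType) (C : numClosedFieldType).
Implicit Types (A D eta : mulchar F C).

Lemma mulchar_oneE (x : F) : (1%g : mulchar F C) x = (x != 0)%:R.
Proof. by rewrite ffunE. Qed.

Lemma mulchar_mulE A D (x : F) : (A * D)%g x = A x * D x.
Proof. by rewrite ffunE. Qed.

Lemma mulchar_expgE A k (x : F) : x != 0 -> (A ^+ k)%g x = A x ^+ k.
Proof.
move=> x0; elim: k => [|k IHk]; first by rewrite expg0 mulchar_oneE x0.
by rewrite expgS mulchar_mulE IHk exprS.
Qed.

Lemma mulcharV A (x : F) : A x^-1 = (A x)^-1.
Proof.
have [->|x0] := eqVneq x 0; first by rewrite !(invr0, mulchar0).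
by apply: (mulfI (mulchar_neq0 A x0)); rewrite -mulcharM !mulfV ?mulchar1 ?mulchar_neq0.
Qed.

Lemma mulchar_invE A (x : F) : (A^-1)%g x = A x^-1.
Proof. by rewrite ffunE mulcharV. Qed.

Lemma closed_prim_root k : (0 < k)%N -> exists z : C, k.-primitive_root z.
Proof.
move=> k0; have [s Es] := closed_field_poly_normal ('X^k - 1 : {poly C}).
have {Es} Es : 'X^k - 1 = \prod_(z <- s) ('X - z%:P).
  by rewrite Es (monicP _) ?scale1r ?monicXnsubC.
have [| | |z _ zP] := hasP (@cyclic.has_prim_root C k s k0 _ _ _); last by exists z.
- by apply/allP => z zs; rewrite /root_of_unity Es root_prod_XsubC.
- by rewrite -separable_prod_XsubC -Es separable_Xn_sub_1 // pnatr_eq0 -lt0n.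
- by rewrite -ltnS -(size_prod_XsubC s id) -Es size_XnsubC.
Qed.

(** Send a generator of the multiplicative group to a primitive root of unity of
    the same order; the resulting character is injective. *)
Lemma mulchar_separates (y : F) : y != 0 -> y != 1 -> exists eta, eta y != 1.
Proof.
move=> y0 y1; have [g gP] := finfield_prim_root F.
have [z zP] := closed_prim_root (prim_order_gt0 gP).
pose dlog x : nat := if [pick i : 'I_#|F|.-1 | x == g ^+ i] is Some i then i else 0%N.
have dlogK x : x != 0 -> g ^+ dlog x = x.
  move=> x0; rewrite /dlog; case: pickP => [i /eqP //|].
  have q0 : (0 < #|F|)%N by apply/card_gt0P; exists 0.
  have [|i ->] := prim_rootP gP (_ : x ^+ #|F|.-1 = 1).
    by apply: (mulfI x0); rewrite -exprS prednK // expf_card mulr1.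
  by move/(_ i); rewrite eqxx.
have etaP : is_mulchar [ffun x => if x == 0 then 0 else z ^+ dlog x].
  apply/and3P; split; first by rewrite ffunE eqxx.
    apply/forallP => x; apply/implyP => x0; rewrite ffunE (negbTE x0) expf_neq0 //.
    apply: contra_neq (oner_neq0 C) => z0; rewrite -(prim_expr_order zP) z0 expr0n.
    by rewrite gtn_eqF // (prim_order_gt0 gP).
  apply/forallP => x; apply/forallP => w; apply/implyP => /andP[x0 w0].
  rewrite !ffunE mulf_eq0 (negbTE x0) (negbTE w0) /= -exprD (eq_prim_root_expr zP).
  by rewrite -(eq_prim_root_expr gP) exprD !dlogK ?mulf_neq0.
exists (MulChar etaP); rewrite /= ffunE (negbTE y0) -(prim_order_dvd zP) (prim_order_dvd gP).
by rewrite dlogK.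
Qed.

Lemma sum_mulchar_values eta : eta != 1%g -> \sum_(x : F) eta x = 0.
Proof.
move=> eta1; have [x0 /andP[x00 ex0]] : exists x0, (x0 != 0) && (eta x0 != 1).
  apply/existsP; apply: contraNT eta1 => /existsPn h; apply/eqP/mulcharP => x.
  rewrite mulchar_oneE; have [->|x0] := eqVneq x 0; first by rewrite mulchar0.
  by have := h x; rewrite x0 negbK => /eqP.
have : (eta x0 - 1) * \sum_(x : F) eta x = 0.
  rewrite mulrBl mul1r mulr_sumr [X in _ - X](reindex_inj (mulfI x00)) /=.
  by apply/eqP; rewrite subr_eq0; apply/eqP/eq_bigr => x _; rewrite mulcharM.
by move/eqP; rewrite mulf_eq0 subr_eq0 (negbTE ex0) => /eqP.
Qed.

Lemma sum_mulchars_neq1 (y : F) : y != 1 -> \sum_(eta : mulchar F C) eta y = 0.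
Proof.
have [-> _|y0 y1] := eqVneq y 0; first by rewrite big1 // => eta _; rewrite mulchar0.
have [e0 e0y] := mulchar_separates y0 y1.
have : (e0 y - 1) * \sum_(eta : mulchar F C) eta y = 0.
  rewrite mulrBl mul1r mulr_sumr [X in _ - X](reindex_inj (mulgI e0)) /=.
  by apply/eqP; rewrite subr_eq0; apply/eqP/eq_bigr => eta _; rewrite mulchar_mulE.
by move/eqP; rewrite mulf_eq0 subr_eq0 (negbTE e0y) => /eqP.
Qed.

(** The number of characters is found by summing all values of all characters in
    both orders, using that nontrivial characters have sum zero. *)
Lemma sum_mulchars (y : F) :
  \sum_(eta : mulchar F C) eta y = (y == 1)%:R * (#|F|%:R - 1).
Proof.
have [->|y1] := eqVneq y 1; last by rewrite sum_mulchars_neq1 // mul0r.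
transitivity (\sum_(x : F) \sum_(eta : mulchar F C) eta x).
  by rewrite [RHS](bigD1 1) //= [X in _ + X]big1 ?addr0 // => x; apply: sum_mulchars_neq1.
rewrite exchange_big (bigD1 1%g) //= [X in _ + X]big1 ?addr0 => [|eta];
  last exact: sum_mulchar_values.
under eq_bigr => x _ do rewrite mulchar_oneE.
rewrite mul1r (bigD1 0) //= eqxx add0r.
rewrite (eq_bigr (fun=> 1)) => [|x ->] //.
by rewrite sumr_const cardC1 -subn1 natrB //; apply/card_gt0P; exists 0.
Qed.

(** Expand both binomials into Jacobi sums; the factors eta(-1) cancel and the
    sum over eta is evaluated by orthogonality. *)
Lemma hyp2F1_point_sum A D (x : F) :
  #|F|%:R * hyp2F1 A D 1%g x =
  \sum_(s : F) \sum_(t : F) A s * D t * (x * s * t / ((1 - s) * (1 - t)) == 1)%:R.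
Proof.
have q0 : (#|F|%:R : C) != 0 by rewrite pnatr_eq0 -lt0n; apply/card_gt0P; exists 0.
have q1 : (#|F|%:R : C) - 1 != 0.
  by rewrite subr_eq0 -[1]/(1%:R) eqr_nat gtn_eqF // finNzRing_gt1.
have E : \sum_(eta : mulchar F C) binom_char (A * eta)%g eta * binom_char (D * eta)%g (1 *
  eta)%g * eta x =
   #|F|%:R^-1 ^+ 2 * ((#|F|%:R - 1) *
  \sum_(s : F) \sum_(t : F) A s * D t * (x * s * t / ((1 - s) * (1 - t)) == 1)%:R).
  transitivity (\sum_(eta : mulchar F C) #|F|%:R^-1 ^+ 2 *
     \sum_(s : F) \sum_(t : F) A s * D t * eta (x * s * t / ((1 - s) * (1 - t)))).
    apply: eq_bigr => eta _; rewrite mul1g /binom_char /jacobi_sum.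
    transitivity (#|F|%:R^-1 ^+ 2 * (eta (-1) * eta (-1)) * (\sum_s (A * eta)%g s * (eta^-1)%g
      (1 - s)) *
        (\sum_s (D * eta)%g s * (eta^-1)%g (1 - s)) * eta x); first by ring.
    rewrite -mulcharM mulrNN mulr1 mulchar1 mulr1 -!mulrA; congr (_ * (_ * _)).
    rewrite mulr_suml; apply: eq_bigr => s _; rewrite [X in _ * X = _]mulrC mulrA mulr_sumr.
    apply: eq_bigr => t _; rewrite !mulchar_mulE !mulchar_invE invfM !mulcharM; ring.
  rewrite -mulr_sumr; congr (_ * _); rewrite exchange_big mulr_sumr; apply: eq_bigr => s _.
  rewrite exchange_big mulr_sumr; apply: eq_bigr => t _.
  by rewrite -mulr_sumr sum_mulchars; ring.
rewrite /hyp2F1 E; field; rewrite q0 q1 //.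
Qed.
End Orthogonality.

(** * The hypergeometric value at a character of order 4 *)

Section Order4.
Variables (F : finFieldType) (C : numClosedFieldType) (m : nat).
Hypothesis odd_F : #|F| = m.*2.+1.
Notation phi := (@quadchar F C).
Let two_neq0 : (2 : F) != 0 := two_neq0_odd odd_F.

Lemma quadchar_eq1 x : phi x = 1 -> exists y, x = y ^+ 2.
Proof.
rewrite /quadchar; case: eqP => [_ /eqP|_]; first by rewrite eq_sym oner_eq0.
case: existsP => [[y /eqP ->] _|_ /eqP]; first by exists y.
by rewrite eq_sym -addr_eq0 -[1 + 1]/(2%:R) pnatr_eq0.
Qed.

Lemma quadchar_cases x : x != 0 -> phi x = 1 \/ phi x = -1.
Proof. by rewrite /quadchar => /negbTE ->; case: ifP => _; [left | right]. Qed.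

Section Minus1Square.
Variable i : F.
Hypothesis i2 : i ^+ 2 = -1.

Lemma sqrtN1_neq0 : i != 0.
Proof. by apply/eqP => i0; move/eqP: i2; rewrite i0 expr0n eq_sym oppr_eq0 oner_eq0. Qed.

Lemma quadcharN x : phi (- x) = phi x.
Proof. by rewrite -mulN1r -i2 (quadcharM _ odd_F) quadchar_sqr ?sqrtN1_neq0 // mul1r. Qed.

(** 2 i = (1 + i)^2. *)
Lemma quadchar_2i : phi i * phi 2 = 1.
Proof.
rewrite -(quadcharM _ odd_F) (_ : i * 2 = (1 + i) ^+ 2); last first.
  transitivity ((1 + i) ^+ 2 - 1 - i ^+ 2); first by ring.
  by rewrite i2; ring.
rewrite quadchar_sqr // addrC addr_eq0; apply/eqP => iN1.
by move/eqP: i2; rewrite iN1 sqrrN expr1n (one_eqN1 odd_F).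
Qed.

(** The fibre over z is the root set of w^2 - z w + 1, of discriminant
    (z + 2)(z - 2).  Since w (z + 2) = (w + 1)^2 and w (z - 2) = (w - 1)^2, phi is
    constant on the fibre, with value phi(z + 2) or, at z = -2, phi(z - 2). *)
Lemma sum_joukowski_fibre z :
  \sum_(w : F) (if w == 0 then 0 else (w + w^-1 == z)%:R * phi w) = phi (z + 2) + phi (z - 2).
Proof.
(* With e = 1 or -1, the equation (z + 2e) w = (w + e)^2 determines phi(w). *)
have fibre e : e ^+ 2 = 1 -> z + 2 * e != 0 ->
    \sum_(w : F) (if w == 0 then 0 else (w + w^-1 == z)%:R * phi w)
     = phi (z + 2 * e) + phi (z - 2 * e).
  move=> e2 ze.
  transitivity (\sum_(w : F) phi (z + 2 * e) * (1 * w ^+ 2 + (- z) * w + 1 == 0)%:R).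
    apply: eq_bigr => w _; have [->|w0] := eqVneq w 0.
      by rewrite expr0n !mulr0 !add0r oner_eq0 mulr0.
    have -> : (1 * w ^+ 2 + - z * w + 1 == 0) = (w + w^-1 == z).
      rewrite -[RHS]subr_eq0 -(mulrI_eq0 (w + w^-1 - z) (mulfI w0)).
      by congr (_ == 0); field.
    case: eqP => [wz|_]; last by rewrite mul0r mulr0.
    rewrite mul1r mulr1.
    have E : (z + 2 * e) * w = (w + e) ^+ 2.
      by rewrite -wz; transitivity ((w + e) ^+ 2 + (1 - e ^+ 2));
        [field | rewrite e2 subrr addr0].
    have we0 : w + e != 0.
      by apply: contra_neq (mulf_neq0 ze w0) => we; rewrite E we expr0n.
    have := quadchar_sqr C we0; rewrite -E (quadcharM _ odd_F) => h.
    by rewrite -[LHS]mul1r -[X in X * _](quadchar_unit C odd_F ze) -mulrA h mulr1.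
  rewrite -mulr_sumr (sum_quadratic_roots _ odd_F) ?oner_neq0 //.
  have -> : (- z) ^+ 2 - 4 * 1 * 1 = (z + 2 * e) * (z - 2 * e).
    by transitivity (z ^+ 2 - 4 * e ^+ 2); [rewrite e2 | ]; ring.
  by rewrite (quadcharM _ odd_F) mulrDr mulr1 mulrA (quadchar_unit _ odd_F ze) mul1r.
have [z2|z2] := eqVneq (z + 2) 0; last first.
  by rewrite (fibre 1) ?expr1n // ?mulr1.
rewrite (fibre (-1)) ?sqrrN ?expr1n //.
  by rewrite mulrN1 opprK addrC.
rewrite mulrN1 (_ : z - 2 = (z + 2) - 2 * 2); last by ring.
by rewrite z2 sub0r oppr_eq0 mulf_neq0.
Qed.

Lemma sum_joukowski (G : F -> C) :
  \sum_(w : F | w != 0) phi w * G (w + w^-1) = \sum_z (phi (z + 2) + phi (z - 2)) * G z.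
Proof.
under [RHS]eq_bigr => z _ do rewrite -sum_joukowski_fibre mulr_suml.
rewrite exchange_big big_mkcond /=; apply: eq_bigr => w _.
case: eqP => _ /=; first by rewrite big1 // => z _; rewrite mul0r.
rewrite (bigD1 (w + w^-1)) //= eqxx mul1r big1 ?addr0 // => z.
by rewrite eq_sym => /negbTE ->; rewrite !mul0r.
Qed.

(** Substitute i w for w and divide the argument of phi by w^2: what remains
    depends on z = w + 1/w alone.  The factors phi(i) and phi(2) left over from
    the substitutions w -> i w and z -> 2 x cancel by [quadchar_2i]. *)
Lemma sum_joukowski_ell mu :
  \sum_(w : F) phi w * phi ((1 - w ^+ 2) ^+ 2 - 4 * w ^+ 2 * mu) = 2 * ell_sum C mu.
Proof.
rewrite (reindex_inj (mulfI sqrtN1_neq0)) /=.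
pose G (z : F) := phi (z ^+ 2 + 4 * mu).
have GN z : G (- z) = G z by rewrite /G sqrrN.
transitivity (phi i * \sum_(w : F | w != 0) phi w * G (w + w^-1)).
  rewrite mulr_sumr [RHS]big_mkcond; apply: eq_bigr => w _.
  have [->|w0] := eqVneq w 0; first by rewrite mulr0 quadchar0 mul0r.
  rewrite /= (quadcharM _ odd_F) -mulrA exprMn i2; congr (_ * (_ * _)).
  rewrite -[RHS]mul1r -(quadchar_sqr C w0) -(quadcharM _ odd_F); congr phi.
  by field.
rewrite sum_joukowski.
have half : \sum_z phi (z - 2) * G z = phi 2 * ell_sum C mu.
  rewrite (reindex_inj (mulfI two_neq0)) /= /ell_sum mulr_sumr; apply: eq_bigr => x _.
  rewrite /G -!(quadcharM _ odd_F) -[RHS]mulr1 -(quadchar_sqr C two_neq0) -(quadcharM _ odd_F).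
  by congr phi; ring.
under eq_bigr => z _ do rewrite mulrDl.
rewrite big_split /= half.
have -> : \sum_z phi (z + 2) * G z = phi 2 * ell_sum C mu.
  rewrite -half (reindex_inj oppr_inj) /=; apply: eq_bigr => z _.
  by rewrite GN -[phi (z - 2)]quadcharN opprB addrC.
transitivity (phi i * phi 2 * (2 * ell_sum C mu)); first by ring.
by rewrite quadchar_2i mul1r.
Qed.

Variable chi : mulchar F C.
Hypothesis chi4 : #[chi]%g = 4%N.

Lemma order4_pow4 x : x != 0 -> chi x ^+ 4 = 1.
Proof. by move=> x0; rewrite -mulchar_expgE // -chi4 expg_order mulchar_oneE x0. Qed.

(** The square of chi is a nontrivial character that is 1 on squares, hence -1 on
    the single other coset. *)
Lemma order4_sqr x : x != 0 -> chi x ^+ 2 = phi x.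
Proof.
move=> x0.
have sq y : y != 0 -> chi (y ^+ 2) ^+ 2 = 1.
  by move=> y0; rewrite mulcharX -exprM order4_pow4.
have sgn y : y != 0 -> chi y ^+ 2 = 1 \/ chi y ^+ 2 = -1.
  by move/order4_pow4; rewrite (exprM _ 2 2) => /eqP; rewrite sqrf_eq1 => /orP[] /eqP;
    [left | right].
have [w /andP[w0 cw]] : exists w, (w != 0) && (chi w ^+ 2 != 1).
  apply/existsP; apply: contraT => /existsPn h.
  have : (chi ^+ 2)%g = 1%g.
    apply: mulcharP => y; rewrite mulchar_oneE; have [->|y0] := eqVneq y 0;
      first by rewrite mulchar0.
    by have := h y; rewrite y0 mulchar_expgE // negbK => /eqP.
  by move/eqP; rewrite -order_dvdn chi4.
have cwN : chi w ^+ 2 = -1 by case: (sgn w w0) cw => -> //; rewrite eqxx.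
have phw : phi w = -1.
  case: (quadchar_cases w0) => // /quadchar_eq1 [y wy]; move: w0 cw; rewrite wy.
  by rewrite expf_eq0 /= => y0; rewrite sq // eqxx.
case: (quadchar_cases x0) => [px|px].
  have [y xy] := quadchar_eq1 px; rewrite px.
  by rewrite xy sq //; apply: contraNneq x0 => y0; rewrite xy y0 expr0n.
have [y xwy] : exists y, x * w = y ^+ 2.
  by apply: quadchar_eq1; rewrite (quadcharM _ odd_F) px phw mulrNN mulr1.
have y0 : y != 0 by apply: contraNneq (mulf_neq0 x0 w0) => y0; rewrite xwy y0 expr0n.
have := sq y y0; rewrite -xwy mulcharM exprMn cwN mulrN1 px => /eqP.
by rewrite eqr_oppLR => /eqP.
Qed.

(** If r = w^2 then chi(r) = phi(w) is its own inverse, and w, -w contribute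
    equally since -1 is a square; if r is not a square then chi(r)^2 = -1. *)
Lemma order4_add_inv r : r != 0 ->
  chi r + (chi r)^-1 = \sum_(w : F) phi w * (r == w ^+ 2)%:R.
Proof.
move=> r0; have cr0 := mulchar_neq0 chi r0.
case: (quadchar_cases r0) => [/quadchar_eq1 [w rw]|pr].
  have w0 : w != 0 by apply: contraNneq r0 => w0; rewrite rw w0 expr0n.
  rewrite rw mulcharX order4_sqr // (bigD1 w) //= eqxx (bigD1 (- w)) /=; last first.
    by rewrite eq_sym -addr_eq0 -mulr2n -mulr_natl mulf_neq0.
  rewrite sqrrN eqxx quadcharN !mulr1 big1 ?addr0 => [|v /andP[vw vNw]]; last first.
    by rewrite eq_sym eqf_sqr (negbTE vw) (negbTE vNw) mulr0.
  by congr (_ + _); case: (quadchar_cases w0) => ->; rewrite ?invrN invr1.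
rewrite big1 => [|w _].
  have -> : chi r + (chi r)^-1 = (chi r)^-1 * (chi r ^+ 2 + 1) by field.
  by rewrite order4_sqr // pr addNr mulr0.
case: eqP => [rw|_]; last by rewrite mulr0.
have w0 : w != 0 by apply: contraNneq r0 => w0; rewrite rw w0 expr0n.
move/eqP: pr; rewrite rw quadchar_sqr // -addr_eq0 -[1 + 1]/(2%:R) pnatr_eq0 //.
Qed.

(** The second factor is unchanged under r -> 1/r, so chi(r) may be replaced by
    the mean of chi(r) and its inverse, and the sum then runs over w^2 = r. *)
Lemma sum_order4_ell mu :
  \sum_(r : F) chi r * phi ((1 - r) ^+ 2 - 4 * r * mu) = ell_sum C mu.
Proof.
pose h (r : F) := phi ((1 - r) ^+ 2 - 4 * r * mu).
rewrite -/(h _); have two0 : (2 : C) != 0 by rewrite pnatr_eq0.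
apply: (mulfI two0); rewrite -sum_joukowski_ell mulr2n mulrDl mul1r.
rewrite [X in _ + X](reindex_inj invr_inj) /= -big_split /=.
transitivity (\sum_(r : F) \sum_(w : F) phi w * (r == w ^+ 2)%:R * h r).
  apply: eq_bigr => r _; have [->|r0] := eqVneq r 0.
    rewrite invr0 mulchar0 !mul0r addr0 big1 // => w _.
    have [->|w0] := eqVneq w 0; first by rewrite quadchar0 !mul0r.
    by rewrite eq_sym expf_eq0 (negbTE w0) mulr0 mul0r.
  rewrite -mulr_suml -order4_add_inv // [RHS]mulrDl mulcharV; congr (_ + _ * _).
  rewrite /h -[RHS]mulr1 -(@quadchar_sqr _ C r^-1) ?invr_neq0 // -(quadcharM _ odd_F).
  by congr phi; field.
rewrite exchange_big /=; apply: eq_bigr => w _.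
rewrite (bigD1 (w ^+ 2)) //= eqxx mulr1 big1 ?addr0 // => r /negbTE ->.
by rewrite mulr0 mul0r.
Qed.

Lemma chi_neq1 : chi != 1%g.
Proof. by apply/eqP => c1; move: chi4; rewrite c1 order1. Qed.

(** Setting s = r t in the point sum leaves chi(r) times the number of roots t of
    r (1 + mu) t^2 - (1 + r) t + 1. *)
Lemma hyp2F1_ell_sum mu : mu != 0 -> mu != -1 ->
  #|F|%:R * hyp2F1 chi (chi ^+ 3)%g 1%g (- mu) = ell_sum C mu.
Proof.
move=> mu0 mu1.
have : forall t : F, t != 0 -> (chi ^+ 3)%g t = chi t ^+ 3 by move=> t; apply: mulchar_expgE.
move: (chi ^+ 3)%g => chi3 chi3E.
rewrite hyp2F1_point_sum exchange_big /= -sum_order4_ell.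
transitivity (\sum_(r : F) chi r * \sum_(t : F) (r * (1 + mu) * t ^+ 2 + - (1 + r) * t
  + 1 == 0)%:R).
  under [RHS]eq_bigr => r _ do rewrite mulr_sumr.
  rewrite [RHS]exchange_big /=; apply: eq_bigr => t _; have [->|t0] := eqVneq t 0.
    rewrite !big1 // => r _; first by rewrite expr0n !mulr0 !add0r oner_eq0 mulr0.
    by rewrite mulchar0 mulr0 mul0r.
  rewrite (reindex_inj (mulIf t0)) /=; apply: eq_bigr => r _.
  have [->|r0] := eqVneq r 0; first by rewrite mul0r !mulchar0 !mul0r.
  rewrite chi3E // mulcharM -[_ * _ * chi t ^+ 3]mulrA -exprS order4_pow4 // mulr1;
    congr (_ * (nat_of_bool _)%:R).
  have N0 : - mu * (r * t) * t != 0 by rewrite !mulf_neq0 ?oppr_eq0.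
  have -> : r * (1 + mu) * t ^+ 2 + - (1 + r) * t + 1
    = (1 - r * t) * (1 - t) - - mu * (r * t) * t by ring.
  rewrite subr_eq0; have [->|d0] := eqVneq ((1 - r * t) * (1 - t)) 0.
    by rewrite invr0 mulr0 eq_sym oner_eq0 eq_sym (negbTE N0).
  by rewrite eq_sym -(inj_eq (mulIf d0)) mul1r divfK // eq_sym.
have -> : \sum_(r : F) chi r * phi ((1 - r) ^+ 2 - 4 * r * mu) =
   \sum_(r : F) chi r * (1 + phi ((1 - r) ^+ 2 - 4 * r * mu)).
  under [RHS]eq_bigr => r _ do rewrite mulrDr mulr1.
  by rewrite big_split /= (sum_mulchar_values chi_neq1) add0r.
apply: eq_bigr => r _; have [->|r0] := eqVneq r 0; first by rewrite mulchar0 !mul0r.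
rewrite (sum_quadratic_roots _ odd_F); last by rewrite mulf_neq0 // addrC addr_eq0.
by congr (_ * (1 + phi _)); ring.
Qed.
End Minus1Square.
End Order4.

(** * The sextic curve *)

Theorem theorem6p4 (R : realType) (p n q : nat) (F : finFieldType)
    (p_prime : prime p) (p_odd : odd p) (n_gt0 : (0 < n)%N)
    (q_def : q = (p ^ n)%N) (card_F : #|F| = q)
    (a b : F) (a_neq0 : a != 0) (b_neq0 : b != 0)
    (lambda : F) (lambda_def : lambda = a ^+ 2 / b)
    (lambda_neq0 : lambda != 0) (lambda_neqN1 : lambda != -1) :
  let C : {set (F * F) + F} := model_points (hyp_poly a b) in
  let phi : F -> R[i] := quadchar R[i] in
  [/\ #|C|%:R = 2 + q%:R + psi24 R[i] a b,
      2 + q%:R + psi24 R[i] a b =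
        1 + q%:R - phi (- b) * (aq lambda)%:~R - phi (- a) * (aq (1 / lambda))%:~R
    & forall chi : mulchar F R[i],
        q = 1 %[mod 4] -> #[chi]%g = 4%N ->
        #|C|%:R =
          1 + q%:R
          + q%:R * phi (- b) * hyp2F1 chi (chi ^+ 3)%g 1%g (- lambda)
          + q%:R * phi (- a) * hyp2F1 chi (chi ^+ 3)%g 1%g (-1 / lambda)
        /\ `| phi (- b) * hyp2F1 chi (chi ^+ 3)%g 1%g (- lambda)
              + phi (- a) * hyp2F1 chi (chi ^+ 3)%g 1%g (-1 / lambda) |
           <= 4 / sqrtC q%:R ].
Proof.
move=> C phi.
have cF : #|F| = (p ^ n)%N by rewrite card_F.
have odd_F : #|F| = (#|F|./2).*2.+1.
  by rewrite -[LHS]odd_double_half cF oddX p_odd orbT.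
have psiE : 2 + q%:R + psi24 R[i] a b =
    1 + q%:R + phi (- b) * ell_sum R[i] lambda + phi (- a) * ell_sum R[i] (1 / lambda).
  by rewrite lambda_def /phi -[RHS]addrA -(psi24_split _ odd_F a_neq0 b_neq0); ring.
have cardC : #|C|%:R = 2 + q%:R + psi24 R[i] a b by rewrite (card_hyp_points _ odd_F) card_F.
have aqE (mu : F) : (aq mu)%:~R = - ell_sum R[i] mu by exact: (aq_ell_sum _ odd_F).
split=> //; first by rewrite psiE !aqE; ring.
move=> chi q4 chi4; rewrite cardC psiE.
have [i i2] : exists i : F, i ^+ 2 = -1.
  have N10 : -1 != 0 :> F by rewrite oppr_eq0 oner_eq0.
  have := euler_criterion odd_F N10.
  have ev : ~~ odd #|F|./2 by move: q4; rewrite -card_F odd_F; lia.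
  by rewrite -signr_odd (negbTE ev) expr0 eqxx => /existsP[i /eqP ->]; exists i.
have hypE (mu : F) : mu != 0 -> mu != -1 ->
    hyp2F1 chi (chi ^+ 3)%g 1%g (- mu) = ell_sum R[i] mu / q%:R.
  move=> mu0 mu1; rewrite -(hyp2F1_ell_sum odd_F i2 chi4 mu0 mu1) card_F mulrC mulKf //.
  by rewrite pnatr_eq0 -card_F odd_F.
have inv0 : 1 / lambda != 0 by rewrite div1r invr_eq0.
have invN1 : 1 / lambda != -1.
  by rewrite div1r; apply: contra_neq lambda_neqN1 => h; rewrite -[lambda]invrK h invrN invr1.
rewrite mulNr !hypE //.
have q0 : (0 : R[i]) < q%:R by rewrite ltr0n -card_F odd_F.
split; first by field; rewrite gt_eqF.
have bound (mu : F) : mu != 0 -> mu != -1 -> `|ell_sum R[i] mu| <= 2 * sqrtC q%:R.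
  move=> mu0 mu1; rewrite -[X in `|X|]opprK -aqE normrN.
  rewrite -ler_sqr ?nnegrE ?mulr_ge0 ?sqrtC_ge0 ?ler0n //.
  rewrite exprMn sqrtCK -normrX ger0_norm -rmorphXn /=; last by rewrite ler0z sqr_ge0.
  have := hasse_aq R[i] odd_F p_prime cF mu0 mu1.
  rewrite -(ler_int R[i]) card_F => /le_trans; apply.
  by rewrite rmorphM /= -!pmulrn -natrX.
have s0 : 0 < sqrtC (q%:R : R[i]) by rewrite sqrtC_gt0.
rewrite !mulrA -mulrDl normrM normfV (ger0_norm (ltW q0)) ler_pdivrMr //.
have -> : 4 / sqrtC q%:R * q%:R = 2 * sqrtC q%:R + 2 * sqrtC q%:R :> R[i].
  rewrite -[X in _ / _ * X = _]sqrtCK; move: (sqrtC _) s0 => s s0.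
  by field; rewrite gt_eqF.
apply: le_trans (ler_normD _ _) _; rewrite !normrM.
apply: lerD.
  by apply: le_trans (ler_piMl _ (quadchar_norm _ _)) (bound _ _ _).
by apply: le_trans (ler_piMl _ (quadchar_norm _ _)) (bound _ _ _).
Qed.
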